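(* Let $Q$ be a bipartite quiver with source vertices $Q_0^+=\{v_1,\dots,v_n\}$ and sink vertices $Q_0^-=\{w_1,\dots,w_m\}$, let $\mathbf d\in\mathbb N^{Q_0}$ be a dimension vector, and let $\sigma\in\mathbb Z^{Q_0}$ be an integral weight with $\sigma\cdot\mathbf d=0$, positive on $Q_0^+$ and negative on $Q_0^-$. Let $V\in\operatorname{rep}(Q,\mathbf d)$ be a real $\mathbf d$-dimensional representation of $Q$. Then $$\mathbf D_Q(V,\sigma)>0\iff V\text{ is }\sigma\text{-semi-stable}.$$
   Context: A quiver $Q=(Q_0,Q_1,t,h)$ has finite sets $Q_0$ of vertices and $Q_1$ of arrows, and tail and head maps $t,h:Q_1\to Q_0$; quivers are assumed connected. $Q$ is bipartite if $Q_0$ is the disjoint union of $Q_0^+=\{v_1,\dots,v_n\}$ and $Q_0^-=\{w_1,\dots,w_m\}$ and every arrow goes from $Q_0^+$ to $Q_0^-$. $\mathcal A_{i,j}$ is the set of arrows from $v_i$ to $w_j$. $\mathbb N=\{0,1,\dots\}$ and $[L]=\{1,\dots,L\}$. For $\theta,\beta\in\mathbb R^{Q_0}$, $\theta\cdot\beta=\sum_{x\in Q_0}\theta(x)\beta(x)$. A (real) representation $V$ of $Q$ consists of finite-dimensional real vector spaces $V(x)$, $x\in Q_0$, and linear maps $V(a):V(ta)\to V(ha)$, $a\in Q_1$; $\mathbf{dim}\,V=(\dim_{\mathbb R}V(x))_{x\in Q_0}$. A subrepresentation $V'\le V$ is given by subspaces $V'(x)\le V(x)$ with $V(a)(V'(ta))\subseteq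 V'(ha)$ for all $a$, with the restricted maps. $\operatorname{rep}(Q,\mathbf d)=\prod_{a\in Q_1}\mathbb R^{\mathbf d(ha)\times\mathbf d(ta)}$, i.e. $V(x)=\mathbb R^{\mathbf d(x)}$ and the $V(a)$ are matrices. $V$ is $\sigma$-semi-stable if $\sigma\cdot\mathbf{dim}\,V=0$ and $\sigma\cdot\mathbf{dim}\,V'\le0$ for all subrepresentations $V'\le V$. Capacity. Put $\sigma_+(v_i)=\sigma(v_i)$, $\sigma_-(w_j)=-\sigma(w_j)$, $N=\sum_{i=1}^n\sigma_+(v_i)\mathbf d(v_i)=\sum_{j=1}^m\sigma_-(w_j)\mathbf d(w_j)$, $M=\sum_j\sigma_-(w_j)$, $M'=\sum_i\sigma_+(v_i)$, $\mathcal I_j^-=\{q\in\mathbb Z:\sum_{k=1}^{j-1}\sigma_-(w_k)<q\le\sum_{k=1}^{j}\sigma_-(w_k)\}$ and $\mathcal I_i^+=\{r\in\mathbb Z:\sum_{k=1}^{i-1}\sigma_+(v_k)<r\le\sum_{k=1}^{i}\sigma_+(v_k)\}$. View $N\times N$ matrices as $M\times M'$ block matrices in which, for $q\in\mathcal I_j^-$ and $r\in\mathcal I_i^+$, the $(q,r)$ block has size $\mathbf d(w_j)\times\mathbf d(v_i)$. For $i\in[n]$, $j\in[m]$, $a\in\mathcal A_{i,j}$, $q\in\mathcal I_j^-$, $r\in\mathcal I_i^+$, let $V^{i,j,a}_{q,r}$ be the $N\times N$ matrix whose $(q,r)$ block is $V(a)$ and whose other blocks are zero. The Brascamp-Lieb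 operator is $$T_{V,\sigma}:\mathbb R^{N\times N}\to\mathbb R^{N\times N},\qquad T_{V,\sigma}(X)=\sum_{(i,j,a,q,r)}(V^{i,j,a}_{q,r})^T\,X\,V^{i,j,a}_{q,r},$$ and the capacity is $\mathbf D_Q(V,\sigma)=\inf\{\det(T_{V,\sigma}(X)) : X\in\mathcal S_N^+,\ \det X=1\}$, where $\mathcal S^+_d$ is the set of $d\times d$ symmetric positive definite real matrices. *)

(* Defs.v *)
From mathcomp Require Import all_boot all_order all_algebra.
From mathcomp Require Import boolp classical_sets reals.

Set Implicit Arguments.
Unset Strict Implicit.
Unset Printing Implicit Defensive.

Import Order.TTheory GRing.Theory Num.Theory.

Local Open Scope ring_scope.

Record quiver := Quiver {
  vertex :> finType;
  arrow : finType;
  qtail : arrow -> vertex;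
  qhead : arrow -> vertex
}.

Definition adjacent (Q : quiver) : rel Q := fun x y =>
  [exists a : arrow Q, ((qtail a == x) && (qhead a == y))
                    || ((qtail a == y) && (qhead a == x))].

Definition quiver_connected (Q : quiver) : Prop :=
  forall x y : Q, connect (@adjacent Q) x y.

(* Q_0 is the disjoint union of {v_1, .., v_n} and {w_1, .., w_m} (each
   enumerated without repetition), and all arrows go from a v_i to a w_j. *)
Definition bipartition (Q : quiver) (n m : nat)
    (v : 'I_n -> Q) (w : 'I_m -> Q) : Prop :=
  [/\ bijective (fun s : 'I_n + 'I_m =>
                   match s with inl i => v i | inr j => w j end),
      forall a : arrow Q, exists i : 'I_n, qtail a = v i
    & forall a : arrow Q, exists j : 'I_m, qhead a = w j].

Definition rep (R : realType) (Q : quiver) (d : Q -> nat) : Type :=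
  forall a : arrow Q, 'M[R]_(d (qhead a), d (qtail a)).

Definition pairing (Q : quiver) (theta : Q -> int) (beta : Q -> nat) : int :=
  \sum_(x : Q) theta x * (beta x)%:Z.

Section Semistability.
Variables (R : realType) (Q : quiver) (d : Q -> nat).

Definition subrep (V : rep R d) (W : forall x : Q, {vspace 'cV[R]_(d x)}) :
    Prop :=
  forall (a : arrow Q) (u : 'cV[R]_(d (qtail a))),
    u \in W (qtail a) -> V a *m u \in W (qhead a).

Definition semistable (sigma : Q -> int) (V : rep R d) : Prop :=
  pairing sigma d = 0 /\
  forall W : (forall x : Q, {vspace 'cV[R]_(d x)}),
    subrep V W -> pairing sigma (fun x => \dim (W x)) <= 0.

End Semistability.

Definition posdef (R : realType) (N : nat) (X : 'M[R]_N) : Prop :=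
  X^T = X /\ forall u : 'cV[R]_N, u != 0 -> 0 < (u^T *m X *m u) 0 0.

Section Capacity.
Variables (R : realType) (Q : quiver) (d : Q -> nat) (n m : nat).
Variables (v : 'I_n -> Q) (w : 'I_m -> Q) (sigma : Q -> int).

(* For sigma positive on the sources and negative on the sinks, these are
   sigma(v_i) and - sigma(w_j). *)
Definition sigma_plus (i : 'I_n) : nat := `|sigma (v i)|%N.
Definition sigma_minus (j : 'I_m) : nat := `|sigma (w j)|%N.

Definition nblock_rows : nat := (\sum_(j < m) sigma_minus j)%N.
Definition nblock_cols : nat := (\sum_(i < n) sigma_plus i)%N.

(* Block positions q, r are counted from 0, hence the successors: q.+1 is the
   1-based position. *)
Definition Iminus (j : 'I_m) : {set 'I_nblock_rows} :=
  [set q : 'I_nblock_rows |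
    \sum_(k < m | k < j) sigma_minus k < q.+1
      <= \sum_(k < m | k <= j) sigma_minus k]%N.

Definition Iplus (i : 'I_n) : {set 'I_nblock_cols} :=
  [set r : 'I_nblock_cols |
    \sum_(k < n | k < i) sigma_plus k < r.+1
      <= \sum_(k < n | k <= i) sigma_plus k]%N.

(* The unique j with q in I_j^-, resp. the unique i with r in I_i^+
   (see [mem_Iminus] and [mem_Iplus] below). *)
Definition row_sink (q : 'I_nblock_rows) : 'I_m := tagnat.sig1 q.
Definition col_source (r : 'I_nblock_cols) : 'I_n := tagnat.sig1 r.

Definition row_size (q : 'I_nblock_rows) : nat := d (w (row_sink q)).
Definition col_size (r : 'I_nblock_cols) : nat := d (v (col_source r)).

(* By [NrowsE] and [NcolsE] below these are
     \sum_j sigma_minus(w_j) d(w_j)  and  \sum_i sigma_plus(v_i) d(v_i).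
   They have a common value N when sigma . d = 0 (see [sizeE]); keeping them
   apart avoids casting N x N matrices along this equality. *)
Definition Nrows : nat := (\sum_(q < nblock_rows) row_size q)%N.
Definition Ncols : nat := (\sum_(r < nblock_cols) col_size r)%N.

Definition arrows_between (i : 'I_n) (j : 'I_m) : {set arrow Q} :=
  [set a : arrow Q | (qtail a == v i) && (qhead a == w j)].

(* It is only used for a in A_{i,j}, q in I_j^- and r in I_i^+; the (q, r)
   block then has the dimensions of V a, so that [conform_mx] only transports
   V a along the equalities of dimensions. *)
Definition BL_block (V : rep R d) (a : arrow Q)
    (q : 'I_nblock_rows) (r : 'I_nblock_cols) : 'M[R]_(Nrows, Ncols) :=
  \mxblock_(q' < nblock_rows, r' < nblock_cols)
    (if (q' == q) && (r' == r)
     then conform_mx (0 : 'M[R]_(row_size q', col_size r')) (V a)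
     else 0).

Definition BL_operator (V : rep R d) (X : 'M[R]_Nrows) : 'M[R]_Ncols :=
  \sum_(i < n) \sum_(j < m) \sum_(a in arrows_between i j)
    \sum_(q in Iminus j) \sum_(r in Iplus i)
      (BL_block V a q r)^T *m X *m BL_block V a q r.

(* A real infimum: the set is nonempty (X = 1) and bounded below by 0. *)
Definition BL_capacity (V : rep R d) : R :=
  inf [set \det (BL_operator V X) |
        X in [set X : 'M[R]_Nrows | posdef X /\ \det X = 1]]%classic.

End Capacity.

Lemma mem_interval (n : nat) (p : 'I_n -> nat) (s : 'I_(\sum_i p i)) (i : 'I_n) :
  (\sum_(k < n | k < i) p k < s.+1 <= \sum_(k < n | k <= i) p k)%N
    = (tagnat.sig1 s == i).
Proof.
have sumS (l : 'I_n) :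
    (\sum_(k < n | k <= l) p k = \sum_(k < n | k < l) p k + p l)%N.
  rewrite (bigD1 l) //= addnC; congr addn.
  by apply: eq_bigl => k; rewrite ltn_neqAle andbC.
have mono (l l' : 'I_n) : (l < l')%N ->
    (\sum_(k < n | k <= l) p k <= \sum_(k < n | k < l') p k)%N.
  move=> ll'; rewrite [leqRHS](bigID (fun k : 'I_n => k <= l)%N) /=.
  rewrite [X in (_ <= X + _)%N](eq_bigl (fun k : 'I_n => k <= l)%N).
    exact: leq_addr.
  move=> k; case: (leqP k l) => kl; last by rewrite andbF.
  by rewrite (leq_ltn_trans kl ll').
have lo := tagnat.rect s; have hi := ltn_ord (tagnat.sig2 s).
have hi' : (s < \sum_(k < n | k <= tagnat.sig1 s) p k)%N.
  by rewrite sumS [X in (X < _)%N]lo ltn_add2l.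
have lo' : (\sum_(k < n | k < tagnat.sig1 s) p k <= s)%N.
  by rewrite [leqRHS]lo leq_addr.
rewrite ltnS; apply/idP/eqP => [/andP[a b]|<-]; last by rewrite lo' hi'.
apply/val_inj; case: (ltngtP (tagnat.sig1 s) i) => // lt.
- by have := leq_trans (leq_trans hi' (mono _ _ lt)) a; rewrite ltnn.
- by have := leq_trans (leq_trans b (mono _ _ lt)) lo'; rewrite ltnn.
Qed.

Lemma mem_Iminus (Q : quiver) (m : nat) (w : 'I_m -> Q) (sigma : Q -> int)
    (j : 'I_m) (q : 'I_(nblock_rows w sigma)) :
  (q \in Iminus w sigma j) = (row_sink q == j).
Proof. by rewrite inE; exact: mem_interval. Qed.

Lemma mem_Iplus (Q : quiver) (n : nat) (v : 'I_n -> Q) (sigma : Q -> int)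
    (i : 'I_n) (r : 'I_(nblock_cols v sigma)) :
  (r \in Iplus v sigma i) = (col_source r == i).
Proof. by rewrite inE; exact: mem_interval. Qed.

Lemma sum_blocks (n : nat) (p c : 'I_n -> nat) :
  (\sum_(s < \sum_i p i) c (tagnat.sig1 s) = \sum_(i < n) p i * c i)%N.
Proof.
transitivity (\sum_(t : {i : 'I_n & 'I_(p i)}) c (tag t))%N.
  by rewrite (reindex _ tagnat.sig_bij_on).
transitivity (\sum_(i < n) \sum_(k < p i) c i)%N.
  by rewrite sig_big_dep; apply: eq_bigl => -[].
by apply: eq_bigr => i _; rewrite sum_nat_const card_ord.
Qed.

Lemma NrowsE (Q : quiver) (d : Q -> nat) (m : nat) (w : 'I_m -> Q)
    (sigma : Q -> int) :
  Nrows d w sigma = (\sum_(j < m) sigma_minus w sigma j * d (w j))%N.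
Proof. exact: sum_blocks. Qed.

Lemma NcolsE (Q : quiver) (d : Q -> nat) (n : nat) (v : 'I_n -> Q)
    (sigma : Q -> int) :
  Ncols d v sigma = (\sum_(i < n) sigma_plus v sigma i * d (v i))%N.
Proof. exact: sum_blocks. Qed.

Lemma sizeE (Q : quiver) (d : Q -> nat) (n m : nat)
    (v : 'I_n -> Q) (w : 'I_m -> Q) (sigma : Q -> int) :
  bipartition v w -> (forall i, 0 < sigma (v i)) ->
  (forall j, sigma (w j) < 0) -> pairing sigma d = 0 ->
  Nrows d w sigma = Ncols d v sigma.
Proof.
move=> [bij_vw _ _] sv sw; rewrite /pairing.
rewrite (reindex _ (onW_bij _ bij_vw)) /= big_sumType /= => h.
apply/eqP; rewrite NrowsE NcolsE eq_sym -(eqr_nat int) -subr_eq0 !natr_sum.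
apply/eqP; rewrite -[RHS]h -sumrN; congr (_ + _); apply: eq_bigr => k _.
  by rewrite natrM !natz /sigma_plus gtz0_abs.
by rewrite natrM !natz /sigma_minus ltz0_abs // mulNr opprK.
Qed.

(* Main.v *)
Require Import Defs.
From mathcomp Require Import all_boot all_order all_algebra.
From mathcomp Require Import perm.
From mathcomp Require Import boolp classical_sets reals.
From mathcomp Require Import topology normedtype derive.
From mathcomp Require Import ring lra zify.

Set Implicit Arguments.
Unset Strict Implicit.
Unset Printing Implicit Defensive.

Import Order.TTheory GRing.Theory Num.Theory.
Import numFieldNormedType.Exports.

Local Open Scope ring_scope.

(* The Brascamp-Lieb operator is a completely positive map
   T(X) = sum_k A_k^T X A_k, and the proof goes through the condition that T is
   rank non-decreasing: dim U <= dim (sum_k A_k U) for every subspace U.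

   Capacity and rank (Gurvits). Gaussian elimination with diagonal pivoting
   writes a positive definite X as H^T D H, where D > 0 is diagonal and H
   ranges over the compact set of matrices with entries in [-1, 1] and
   determinant +-1.  Dropping rank-one terms bounds det T(X) below by
   det X * det(h_i A_{f(i)})_i ^ 2 for every choice function f, h_i being the
   rows of H.  If T is rank non-decreasing, Rado's theorem on independent
   transversals gives, for each H, some f with nonzero determinant, and
   compactness makes the bound uniform.  Conversely, if U is mapped into a
   smaller Z, letting X degenerate on Z drives the capacity to 0.

   Rank and stability. Let W(v_i) be the sum of the projections of U to the
   blocks of v_i, and W(w_j) = sum_a V(a) W(ta).  Replacing U by the direct sum
   of the W(v_i) over the block positions enlarges it without changing its
   image, which is the direct sum of the W(w_j); comparing dimensions is then
   semi-stability tested on the subrepresentation W. *)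

(** * Pivoted elimination of positive definite matrices *)

Lemma posdef_congr (R : realType) (N K : nat) (X : 'M[R]_N) (P : 'M[R]_(N, K)) :
  posdef X -> (forall u : 'cV_K, P *m u = 0 -> u = 0) ->
  posdef (P^T *m X *m P).
Proof.
move=> [symX posX] injP; split=> [|u u0].
  by rewrite !trmx_mul trmxK symX mulmxA.
have Pu0 : P *m u != 0 by apply: contraNneq u0 => /injP ->.
by have := posX _ Pu0; rewrite trmx_mul !mulmxA.
Qed.

Lemma posdef_entry (R : realType) (N : nat) (X : 'M[R]_N) (i j : 'I_N) :
  (delta_mx i 0 : 'cV_N)^T *m X *m (delta_mx j 0 : 'cV_N) = (X i j)%:M.
Proof.
rewrite trmx_delta -rowE -colE.
by apply/matrixP => k l; rewrite !ord1 !mxE mulr1n.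
Qed.

Lemma posdef_diag_gt0 (R : realType) (N : nat) (X : 'M[R]_N) (i : 'I_N) :
  posdef X -> 0 < X i i.
Proof.
move=> [_ posX].
have : (delta_mx i 0 : 'cV[R]_N) != 0.
  by apply/eqP => /matrixP/(_ i 0)/eqP; rewrite !mxE !eqxx oner_eq0.
by move/posX; rewrite posdef_entry mxE mulr1n.
Qed.

(** Positivity on e_i + e_j and e_i - e_j bounds |X i j| by the mean of the two diagonal entries. *)
Lemma posdef_offdiag (R : realType) (N : nat) (X : 'M[R]_N) (i j : 'I_N) :
  posdef X -> X j j <= X i i -> `|X i j| <= X i i.
Proof.
move=> pX Xji; have [->|ij] := eqVneq i j.
  by rewrite ger0_norm // ltW ?posdef_diag_gt0.
have [symX posX] := pX.
have pos (c : R) : 0 < X i i + c * X i j + c * (X i j + c * X j j).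
  pose u := (delta_mx i 0 : 'cV[R]_N) + c *: delta_mx j 0.
  have u0 : u != 0.
    apply/eqP => /matrixP/(_ i 0)/eqP; rewrite !mxE !eqxx (negbTE ij) mulr0.
    by rewrite addr0 oner_eq0.
  have := posX _ u0.
  have -> : u^T = (delta_mx i 0 : 'cV_N)^T + c *: (delta_mx j 0 : 'cV_N)^T.
    by apply/matrixP => k l; rewrite !mxE.
  rewrite !mulmxDl !mulmxDr.
  rewrite -!scalemxAl -!scalemxAr !posdef_entry !mxE !mulr1n.
  have -> : X j i = X i j by rewrite -[in LHS]symX mxE.
  by rewrite [c * (_ + _)]mulrDr.
have := pos 1; have := pos (-1).
rewrite ler_norml => h1 h2.
apply/andP; split; lra.
Qed.

(* Pivoting on the largest diagonal entry keeps the entries of [H] in [-1, 1]: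
   this replaces the spectral theorem, the set of such [H] being compact. *)
Lemma posdef_pivoted_LDL (R : realType) (N : nat) (X : 'M[R]_N) : posdef X ->
  exists (H : 'M[R]_N) (D : 'rV[R]_N),
    [/\ X = H^T *m diag_mx D *m H, forall i j, `|H i j| <= 1,
        \det H ^+ 2 = 1 & forall i, 0 < D 0 i].
Proof.
elim: N X => [|n IHn] X pX.
  exists 1%:M, 0; split=> [|[]//||[]//]; first by apply/matrixP => -[].
  by rewrite det_mx00 expr1n.
pose i0 := [arg max_(i > ord0) X i i]%O.
have maxX i : X i i <= X i0 i0.
  by rewrite /i0; case: Order.TotalTheory.arg_maxP => // k _; apply.
pose s := tperm ord0 i0.
pose X1 : 'M_(1 + n) := (perm_mx s)^T *m X *m perm_mx s.
have permK : perm_mx s *m perm_mx s = 1%:M :> 'M[R]_n.+1.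
  by rewrite -perm_mxM tperm2 perm_mx1.
have X1E i j : X1 i j = X (s i) (s j).
  by rewrite /X1 tr_perm_mx tpermV -row_permE -[s in perm_mx s]tpermV
             -col_permE !mxE.
have pX1 : posdef X1.
  apply: posdef_congr => // u /(congr1 (mulmx (perm_mx s))).
  by rewrite mulmxA permK mul1mx mulmx0.
have [symX1 _] := pX1.
have X1def : X1 = (perm_mx s)^T *m X *m perm_mx s by [].
clearbody X1.
have maxX1 i : X1 i i <= X1 ord0 ord0 by rewrite !X1E tpermL.
have := posdef_diag_gt0 ord0 pX1.
have := fun j => posdef_offdiag pX1 (maxX1 j).
set x := X1 ord0 ord0 => le_x x_gt0.
(* With this [c], the columns of [P] are [X1]-orthogonal to the first basis vector, so
   [P^T *m X1 *m P] is the Schur complement of the pivot [x]. *)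
pose c : 'M[R]_(1, n) := - (x^-1 *: ursubmx X1).
pose P : 'M[R]_(1 + n, n) := col_mx c 1%:M.
have [|H [D [SE Hle Hdet Dpos]]] := IHn (P^T *m X1 *m P).
  apply: posdef_congr => // u /eqP; rewrite mul_col_mx mul1mx.
  by rewrite col_mx_eq0 => /andP[_ /eqP].
(* The block [- c] is the pivot row divided by the pivot; [le_x] keeps its entries in [-1, 1]. *)
pose H1 : 'M[R]_(1 + n) := block_mx 1%:M (- c) 0 H.
pose D1 : 'rV[R]_(1 + n) := row_mx x%:M D.
have lshift0E : lshift n (0 : 'I_1) = ord0 by apply/val_inj.
have cE : c = - (x^-1 *: ursubmx X1) by [].
clearbody c.
have ulE : ulsubmx X1 = x%:M.
  apply/matrixP => i j; rewrite !ord1 !mxE mulr1n /x.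
  by rewrite lshift0E.
have urE : ursubmx X1 = - (x *: c).
  by rewrite cE scalerN opprK scalerA divff ?scale1r ?gt_eqF.
have dlE : dlsubmx X1 = - (x *: c^T).
  by rewrite -[X1]symX1 -trmx_ursub urE !linearN /= linearZ.
have X1b : X1 = block_mx x%:M (- (x *: c)) (- (x *: c^T)) (drsubmx X1).
  by rewrite -ulE -urE -dlE submxK.
have X1F : X1 = H1^T *m diag_mx D1 *m H1.
  rewrite {1}X1b diag_mx_row.
  have -> : diag_mx x%:M = x%:M :> 'M[R]_1.
    by apply/matrixP => i j; rewrite !mxE !ord1.
  rewrite /H1 tr_block_mx !mulmx_block !trmx1 !trmx0.
  rewrite !(mul0mx, mulmx0, mul1mx, mulmx1, addr0, add0r).
  rewrite mul_scalar_mx scalerN.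
  rewrite [(- c)^T]linearN /= !mulNmx mul_mx_scalar mulmxN opprK.
  congr block_mx.
  rewrite -SE {2}X1b /P tr_col_mx trmx1.
  rewrite mul_row_block mul_row_col mul1mx mulmx1 mul_mx_scalar.
  by rewrite subrr mul0mx add0r mul1mx mulmxN -scalemxAr
             -scalemxAl addrA subrr add0r.
have detH1 : \det H1 = \det H by rewrite det_ublock det1 mul1r.
exists (H1 *m perm_mx s), D1; split.
- rewrite trmx_mul !mulmxA -(mulmxA _ _ (diag_mx _)) -(mulmxA _ _ H1) -X1F.
  rewrite X1def !mulmxA.
  rewrite -trmx_mul permK trmx1 mul1mx -mulmxA permK mulmx1 //.
- move=> i j; rewrite -[s]tpermV -col_permE mxE.
  case: (@split_ordP 1 n i) => k ->; case: (@split_ordP 1 n (s j)) => l ->.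
  + by rewrite block_mxEul mxE !ord1 normr1.
  + rewrite block_mxEur cE !mxE opprK normrM.
    rewrite ger0_norm ?invr_ge0 ?(ltW x_gt0) //.
    rewrite mulrC ler_pdivrMr ?mul1r //; apply: le_trans (le_x (rshift 1 l)).
    by rewrite !ord1 lshift0E.
  + by rewrite block_mxEdl mxE normr0 ler01.
  + by rewrite block_mxEdr.
- rewrite det_mulmx detH1 exprMn Hdet mul1r det_perm.
  by rewrite sqrr_sign.
- move=> i; case: (@split_ordP 1 n i) => k ->.
    by rewrite (row_mxEl x%:M D) !ord1 mxE mulr1n.
  by rewrite (row_mxEr x%:M D).
Qed.

(** * Determinant monotonicity and independent transversals *)

Lemma det_posdef_gt0 (R : realType) (N : nat) (X : 'M[R]_N) :
  posdef X -> 0 < \det X.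
Proof.
move=> /posdef_pivoted_LDL[H [D [-> _ detH D_gt0]]].
rewrite !det_mulmx det_tr det_diag mulrAC -expr2 detH mul1r.
by apply: prodr_gt0 => i _; exact: D_gt0.
Qed.

(** Two block factorizations of the same bordered matrix [M], eliminating either the corner 1 or the
    corner [B], compute one determinant. *)
Lemma det_add_rank1 (F : fieldType) (N : nat) (B : 'M[F]_N) (c : 'rV[F]_N) :
  B \in unitmx ->
  \det (B + c^T *m c) = (1 + (c *m invmx B *m c^T) 0 0) * \det B.
Proof.
move=> uB; pose M := block_mx (1%:M : 'M_1) (- c) c^T B.
have -> : \det (B + c^T *m c) = \det M.
  have -> : M = block_mx 1%:M 0 c^T 1%:M
                *m block_mx 1%:M (- c) 0 (B + c^T *m c).
    rewrite mulmx_block !(mul1mx, mulmx1, mul0mx, mulmx0, addr0, add0r).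
    by rewrite mulmxN addrC addrK.
  by rewrite det_mulmx det_lblock det_ublock !det1 !mul1r.
have -> : M = block_mx 1%:M (- (c *m invmx B)) 0 1%:M
              *m block_mx (1%:M + c *m invmx B *m c^T) 0 c^T B.
  rewrite mulmx_block !(mul1mx, mulmx1, mul0mx, mulmx0, addr0, add0r).
  by rewrite !mulNmx mulmxKV // addrK.
rewrite det_mulmx det_lblock det_ublock !det1 !mul1r; congr (_ * _).
by rewrite det_mx11 !mxE.
Qed.

Lemma rank1_form_ge0 (R : realType) (N : nat) (c : 'rV[R]_N) (u : 'cV[R]_N) :
  0 <= (u^T *m (c^T *m c) *m u) 0 0.
Proof.
have -> : u^T *m (c^T *m c) *m u = (c *m u)^T *m (c *m u).
  by rewrite trmx_mul !mulmxA.
by rewrite mxE big_ord1 mxE -expr2 sqr_ge0.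
Qed.

Lemma posdef_add_rank1 (R : realType) (N : nat) (B : 'M[R]_N) (c : 'rV[R]_N) :
  posdef B -> posdef (B + c^T *m c).
Proof.
move=> [symB posB]; split=> [|u u0].
  by rewrite linearD /= trmx_mul trmxK symB.
rewrite mulmxDr mulmxDl mxE (lt_le_trans (posB _ u0)) // lerDl.
exact: rank1_form_ge0.
Qed.

(** The ratio of the determinants is 1 + c B^-1 c^T, and c B^-1 c^T = y^T B y >= 0 for y = B^-1
    c^T. *)
Lemma det_add_rank1_ge (R : realType) (N : nat) (B : 'M[R]_N) (c : 'rV[R]_N) :
  posdef B -> \det B <= \det (B + c^T *m c).
Proof.
move=> pB; have detB := det_posdef_gt0 pB; have [symB posB] := pB.
have uB : B \in unitmx by rewrite unitmxE unitfE gt_eqF.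
rewrite det_add_rank1 // ler_peMl ?(ltW detB) // lerDl.
set y := invmx B *m c^T.
have -> : c *m invmx B *m c^T = y^T *m B *m y.
  by rewrite /y trmx_mul trmxK trmx_inv symB mulmxKV // mulmxA.
have [->|/posB/ltW//] := eqVneq y 0.
by rewrite mulmx0 mxE.
Qed.

Lemma det_add_sum_rank1_ge (R : realType) (N : nat) (B : 'M[R]_N)
    (I : Type) (r : seq I) (c : I -> 'rV[R]_N) :
  posdef B -> \det B <= \det (B + \sum_(i <- r) (c i)^T *m c i).
Proof.
move=> pB; elim: r B pB => [|i r IHr] B pB; first by rewrite big_nil addr0.
rewrite big_cons addrA; apply: le_trans (det_add_rank1_ge (c i) pB) _.
exact/IHr/posdef_add_rank1.
Qed.

(* Rado's argument: as long as some [A i] has two elements [x] and [y], one of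
   them can be removed, by submodularity of the rank. *)
Lemma rado_transversal (F : fieldType) (I K : finType) (n : nat)
    (a : I -> K -> 'rV[F]_n) (A : I -> {set K}) :
  (forall S : {set I},
     #|S| <= \rank (\sum_(i in S) \sum_(k in A i) <<a i k>>)%MS)%N ->
  exists f : I -> K, (#|I| <= \rank (\sum_i <<a i (f i)>>)%MS)%N.
Proof.
pose sp (A' : I -> {set K}) (S : {set I}) : 'M_n :=
  (\sum_(i in S) \sum_(k in A' i) <<a i k>>)%MS.
have spP (A' : I -> {set K}) (S : {set I}) (M : 'M_n) :
    (forall i k, i \in S -> k \in A' i -> (a i k <= M)%MS) -> (sp A' S <= M)%MS.
  move=> h; apply/sumsmx_subP => i iS; apply/sumsmx_subP => k kA.
  by rewrite genmxE h.
have sp_sub (A' : I -> {set K}) (S : {set I}) i k :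
    i \in S -> k \in A' i -> (a i k <= sp A' S)%MS.
  by move=> iS kA; rewrite /sp (sumsmx_sup i) // (sumsmx_sup k) // genmxE.
have [m] := ubnP (\sum_i #|A i|)%N; elim: m A => // m IHm A leA rkA.
have [/existsP[i0 /card_gt1P[x [y [xA yA xy]]]]|] :=
    boolP [exists i, 1 < #|A i|]%N; last first.
  rewrite negb_exists => /forallP A_le1.
  have /fin_all_exists[f fA] i : exists k, A i = [set k].
    apply/cards1P; rewrite eqn_leq leqNgt A_le1 /=.
    have := rkA [set i]; rewrite cards1 big_set1 !lt0n; apply: contraNneq.
    by move/eqP; rewrite cards_eq0 => /eqP->; rewrite big_set0 mxrank0.
  exists f; rewrite -cardsT.
  apply: (leq_trans (rkA [set: I])).
  apply/mxrankS/spP => i k _; rewrite fA inE => /eqP ->.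
  by rewrite (sumsmx_sup i) // genmxE.
pose rem z i := if i == i0 then A i :\ z else A i.
have rem_lt z : z \in A i0 -> (\sum_i #|rem z i| < m)%N.
  move=> zA; rewrite -ltnS; apply: leq_trans leA.
  rewrite ltnS (bigD1 i0) //= [ltnRHS](bigD1 i0) //= /rem eqxx.
  rewrite [in ltnRHS](cardsD1 z) zA add1n addSn ltnS leq_add2l.
  by apply: leq_sum => i /negbTE ->.
have [remx|] := boolP [forall S : {set I}, #|S| <= \rank (sp (rem x) S)]%N.
  exact: (IHm _ (rem_lt _ xA) (fun S => forallP remx S)).
have [remy|] := boolP [forall S : {set I}, #|S| <= \rank (sp (rem y) S)]%N.
  by move=> _; exact: (IHm _ (rem_lt _ yA) (fun S => forallP remy S)).
rewrite !negb_forall => /existsP[T]; rewrite -ltnNge => ltT.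
move=> /existsP[S]; rewrite -ltnNge => ltS.
have mem_i0 z (S' : {set I}) :
    (\rank (sp (rem z) S') < #|S'|)%N -> i0 \in S'.
  apply: contraTT => i0S; rewrite -leqNgt; apply: leq_trans (rkA S') _.
  apply/mxrankS/spP => i k iS kA; apply: sp_sub => //; rewrite /rem.
  by case: eqP iS i0S => // -> ->.
have i0S := mem_i0 _ _ ltS; have i0T := mem_i0 _ _ ltT.
(* At [i0], [x] survives in [rem y] and every other element in [rem x], so the sum of the spans
   loses nothing. Together with [le_cap], the two ranks add up to at least #|S| + #|T| - 1, whereas
   [ltS] and [ltT] allow at most #|S| + #|T| - 2. *)
have le_cup : (#|S :|: T| <= \rank (sp (rem x) S + sp (rem y) T)%MS)%N.
  apply: leq_trans (rkA _) _; apply/mxrankS/spP => i k; rewrite inE => iST kA.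
  have [ii0|ii0] := eqVneq i i0.
    have [kx|kx] := eqVneq k x.
      apply: submx_trans (addsmxSr _ _); apply: sp_sub; rewrite ii0 // /rem.
      by rewrite eqxx !inE kx xy xA.
    apply: submx_trans (addsmxSl _ _); apply: sp_sub; rewrite ii0 // /rem.
    by rewrite eqxx !inE kx -ii0.
  case/orP: iST => iST.
    by apply: submx_trans (addsmxSl _ _); apply: sp_sub; rewrite // /rem ifN.
  by apply: submx_trans (addsmxSr _ _); apply: sp_sub; rewrite // /rem ifN.
have le_cap : (#|(S :&: T) :\ i0| <=
               \rank (sp (rem x) S :&: sp (rem y) T)%MS)%N.
  apply: leq_trans (rkA _) _; apply/mxrankS/spP => i k.
  rewrite !inE => /and3P[ii0 iS iT] kA; rewrite sub_capmx.
  by rewrite !sp_sub // /rem ifN.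
have := mxrank_sum_cap (sp (rem x) S) (sp (rem y) T).
have := cardsUI S T; have := cardsD1 i0 (S :&: T); rewrite inE i0S i0T /=.
by move: ltS ltT le_cup le_cap; clear; lia.
Qed.

Lemma rado_det (F : fieldType) (K : finType) (n : nat)
    (a : 'I_n -> K -> 'rV[F]_n) :
  (forall S : {set 'I_n},
     #|S| <= \rank (\sum_(i in S) \sum_k <<a i k>>)%MS)%N ->
  exists f : 'I_n -> K, \det (\matrix_i a i (f i)) != 0.
Proof.
move=> rka; have [|f] := @rado_transversal _ _ _ _ a (fun=> [set: K]).
  move=> S; apply: leq_trans (rka S) _; apply: mxrankS; apply: sumsmxS => i _.
  by apply/sumsmx_subP => k _; rewrite (sumsmx_sup k) ?inE.
rewrite card_ord => rkf; exists f.
rewrite -unitfE -unitmxE -row_free_unit -row_leq_rank.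
apply: leq_trans rkf _; apply/mxrankS/sumsmx_subP => i _.
by rewrite genmxE -[a i (f i)](rowK (fun i => a i (f i))) row_sub.
Qed.

(** * Uniform lower bound by compactness *)

Lemma continuous_sum_fun (R : realType) (T : topologicalType) (I : finType)
    (f : I -> T -> R) :
  (forall i, continuous (f i)) -> continuous (fun x => \sum_i f i x).
Proof. by move=> cf; apply: continuous_big => //; exact: add_continuous. Qed.

Lemma continuous_prod_fun (R : realType) (T : topologicalType) (I : finType)
    (f : I -> T -> R) :
  (forall i, continuous (f i)) -> continuous (fun x => \prod_i f i x).
Proof.
move=> cf; apply: continuous_big => // z.
by apply: cvgM; [exact: cvg_fst | exact: cvg_snd].
Qed.

Lemma continuous_sqr (R : realType) (T : topologicalType) (f : T -> R) :
  continuous f -> continuous (fun x => f x ^+ 2).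
Proof. by move=> cf x; apply: cvgM; exact: cf. Qed.

Lemma continuous_mulr_const (R : realType) (T : topologicalType) (f : T -> R)
    (c : R) :
  continuous f -> continuous (fun x => f x * c).
Proof. by move=> cf x; apply: cvgM; [exact: cf | exact: cvg_cst]. Qed.

Lemma continuous_det (R : realType) (T : topologicalType) (N : nat)
    (M : T -> 'M[R]_N) :
  (forall i j, continuous (fun x => M x i j)) ->
  continuous (fun x => \det (M x)).
Proof.
move=> cM; apply: continuous_sum_fun => s x; apply: cvgM; first exact: cvg_cst.
by apply: continuous_prod_fun.
Qed.

Definition transversal_mx (F : fieldType) (I : Type) (N : nat)
    (A : I -> 'M[F]_N) (f : 'I_N -> I) (H : 'M[F]_N) : 'M[F]_N :=
  \matrix_i (row i H *m A (f i)).

(** The good [f] depends on [H]; summing the squares over all [f] gives a single continuous function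
    of [H], positive on a compact set, hence with a positive minimum there. *)
Lemma transversal_det_lower_bound (R : realType) (I : finType) (N : nat)
    (A : I -> 'M[R]_N) :
  (forall H : 'M[R]_N, \det H != 0 ->
     exists f : {ffun 'I_N -> I}, \det (transversal_mx A f H) != 0) ->
  exists2 c : R, 0 < c &
    forall H : 'M[R]_N, (forall i j, `|H i j| <= 1) -> \det H ^+ 2 = 1 ->
      c <= \sum_(f : {ffun 'I_N -> I}) \det (transversal_mx A f H) ^+ 2.
Proof.
move=> detA.
(* Matrices are flattened to row vectors, where a product of segments is known to be compact. *)
pose g (x : 'rV[R]_(N * N)) : R :=
  \sum_(f : {ffun 'I_N -> I}) \det (transversal_mx A f (vec_mx x)) ^+ 2.
have cvec i j : continuous (fun x : 'rV[R]_(N * N) => (vec_mx x : 'M_N) i j).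
  rewrite (_ : (fun _ => _) = fun x : 'rV[R]_(N * N) => x 0 (mxvec_index i j)).
    exact: coord_continuous.
  by apply/funext => x; rewrite mxE.
have cdet : continuous (fun x : 'rV[R]_(N * N) => \det (vec_mx x : 'M_N) ^+ 2).
  by apply: continuous_sqr; exact: continuous_det.
have cg : continuous g.
  apply: continuous_sum_fun => f; apply: continuous_sqr.
  apply: continuous_det => i j x.
  rewrite (_ : (fun _ => _) = fun x : 'rV[R]_(N * N) =>
              \sum_k (vec_mx x : 'M_N) i k * A (f i) k j).
    by apply: continuous_sum_fun => k; apply: continuous_mulr_const.
  by apply/funext => z; rewrite !mxE; apply: eq_bigr => k _; rewrite mxE.
pose box :=
  [set x : 'rV[R]_(N * N) | forall k, (-1 <= x ord0 k <= 1)%R]%classic.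
pose D := (box `&`
  [set x : 'rV[R]_(N * N) | (\det (vec_mx x : 'M_N) ^+ 2 = 1)%R])%classic.
have cbox : compact box.
  rewrite (_ : box = [set x | forall k, `[-1, 1]%classic (x ord0 k)]%classic).
    apply: (@rV_compact R (N * N) (fun=> `[-1, 1]%classic)) => _.
    exact: segment_compact.
  by apply/seteqP; split=> x /= bx k; have := bx k; rewrite in_itv.
have cD : compact D.
  apply: (@subclosed_compact _ D box) => //; last by move=> x [].
  apply: closedI.
    by apply: compact_closed cbox; exact: norm_hausdorff.
  apply: (@preimage_closed _ _ _ [set 1 : R]%classic).
    by move=> x _; exact: cdet.
  exact: closed_eq.
have D1 : D (mxvec (1%:M : 'M[R]_N)).
  split=> [k|]; last by rewrite /= mxvecK det1 expr1n.
  case/mxvec_indexP: k => i j; rewrite mxvecE mxE.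
  by case: (i == j); rewrite ?mulr1n ?mulr0n; lra.
have D0 : (D !=set0)%classic by exists (mxvec 1%:M).
have [x xD minx] := compact_EVT_min D0 cD (continuous_subspaceT cg).
exists (g x).
  have [_ /= detx] : D x by move: xD; rewrite inE.
  have [|f detf] := detA (vec_mx x).
    by apply: contra_eqN detx => /eqP ->; rewrite expr0n /= eq_sym oner_eq0.
  rewrite /g (bigD1 f) //= ltr_pwDl ?exprn_even_gt0 //.
  by apply: sumr_ge0 => *; exact: sqr_ge0.
move=> H Hle detH; have := minx (mxvec H); rewrite /g mxvecK; apply.
rewrite inE; split=> [k|]; last by rewrite /= mxvecK.
by case/mxvec_indexP: k => i j; rewrite mxvecE -ler_norml.
Qed.

(** * Capacity of rank non-decreasing maps *)

Definition kraus (R : realType) (I : finType) (N1 N2 : nat)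
    (A : I -> 'M[R]_(N1, N2)) (X : 'M[R]_N1) : 'M[R]_N2 :=
  \sum_k (A k)^T *m X *m A k.

(** Subspaces are row spaces here: if the rows of [U] span a subspace, those of [U *m (A k)^T] span
    its image under [A k] acting on columns. *)
Definition rank_nondecreasing (R : realType) (I : finType) (N1 N2 : nat)
    (A : I -> 'M[R]_(N1, N2)) : Prop :=
  forall U : 'M[R]_N2, (\rank U <= \rank (\sum_k <<U *m (A k)^T>>)%MS)%N.

(** By duality: with Z the sum of the Y A_k, each A_k sends the orthogonal complement of Z into that
    of Y, so N - rank Z <= N - rank Y. *)
Lemma rank_nondecreasing_tr (R : realType) (I : finType) (N : nat)
    (A : I -> 'M[R]_N) (Y : 'M[R]_N) :
  rank_nondecreasing A -> (\rank Y <= \rank (\sum_k <<Y *m A k>>)%MS)%N.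
Proof.
move=> ndA; set Z : 'M_N := (\sum_k _)%MS.
have := ndA (kermx Z^T); rewrite mxrank_ker mxrank_tr => le1.
have le2 : (\rank (\sum_k <<kermx Z^T *m (A k)^T>>)%MS <= N - \rank Y)%N.
  rewrite -(mxrank_tr Y) -mxrank_ker; apply/mxrankS/sumsmx_subP => k _.
  rewrite genmxE; apply/sub_kermxP; rewrite -mulmxA -trmx_mul.
  have /submxP[W ->] : (Y *m A k <= Z)%MS by rewrite (sumsmx_sup k) ?genmxE.
  by rewrite trmx_mul mulmxA mulmx_ker mul0mx.
have := rank_leq_row Z; have := rank_leq_row Y; have := leq_trans le1 le2.
by clear; lia.
Qed.

Lemma congr_diag_mxE (R : comPzRingType) (N K : nat) (D : 'rV[R]_N)
    (W : 'M[R]_(N, K)) :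
  W^T *m diag_mx D *m W = \sum_i D 0 i *: ((row i W)^T *m row i W).
Proof.
apply/matrixP => k l; rewrite mxE summxE; apply: eq_bigr => i _.
rewrite mul_mx_diag !mxE big_ord1 !mxE; ring.
Qed.

Lemma posdef_diag (R : realType) (N : nat) (D : 'rV[R]_N) :
  (forall i, 0 < D 0 i) -> posdef (diag_mx D).
Proof.
move=> D_gt0; split=> [|u u0]; first exact: tr_diag_mx.
have -> : (u^T *m diag_mx D *m u) 0 0 = \sum_i D 0 i * u i 0 ^+ 2.
  rewrite congr_diag_mxE summxE; apply: eq_bigr => i _.
  by rewrite !mxE big_ord1 !mxE expr2.
have /matrix0Pn[i [j]] := u0; rewrite ord1 => ui0.
rewrite (bigD1 i) //= ltr_pwDl //.
  by rewrite mulr_gt0 ?exprn_even_gt0.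
by apply: sumr_ge0 => k _; rewrite mulr_ge0 ?sqr_ge0 // ltW.
Qed.

Lemma rank_sum_rows (F : fieldType) (N : nat) (H : 'M[F]_N) (S : {set 'I_N}) :
  H \in unitmx -> (#|S| <= \rank (\sum_(i in S) <<row i H>>)%MS)%N.
Proof.
move=> uH; set P : 'M_N := (\sum_(i in S) _)%MS.
pose Q : 'M_N := (\sum_(i in ~: S) <<row i H>>)%MS.
have rkQ : (\rank Q <= #|~: S|)%N.
  rewrite -sum1_card /Q; elim/big_ind2: _ => [|? ? ? ? h1 h2|i _].
  - by rewrite mxrank0.
  - exact: leq_trans (mxrank_adds_leqif _ _) (leq_add h1 h2).
  - by rewrite mxrank_gen rank_leq_row.
have : (N <= \rank (P + Q)%MS)%N.
  rewrite -[leqLHS](mxrank_unit uH); apply/mxrankS/row_subP => i.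
  have [iS|iS] := boolP (i \in S).
    by apply: submx_trans (addsmxSl _ _); rewrite /P (sumsmx_sup i) ?genmxE.
  apply: submx_trans (addsmxSr _ _).
  by rewrite /Q (sumsmx_sup i) ?genmxE // inE.
move/leq_trans/(_ (mxrank_adds_leqif P Q)).
by move: rkQ (cardsC S); rewrite card_ord; clear; lia.
Qed.

(** Rado's condition holds for the families (h_i A_k)_k: the rows h_i with i in S span #|S|
    dimensions, and the dual form of rank non-decrease preserves this bound after applying the
    A_k. *)
Lemma rank_nondecreasing_transversal (R : realType) (I : finType) (N : nat)
    (A : I -> 'M[R]_N) (H : 'M[R]_N) :
  rank_nondecreasing A -> \det H != 0 ->
  exists f : {ffun 'I_N -> I}, \det (transversal_mx A f H) != 0.
Proof.
move=> ndA detH; have uH : H \in unitmx by rewrite unitmxE unitfE.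
have [S|f detf] := @rado_det _ I _ (fun i k => row i H *m A k).
  apply: leq_trans (rank_sum_rows S uH) _.
  apply: leq_trans (rank_nondecreasing_tr _ ndA) _.
  apply/mxrankS/sumsmx_subP => k _; rewrite genmxE.
  rewrite sumsmxMr; apply/sumsmx_subP => i iS.
  rewrite (sumsmx_sup i) // (sumsmx_sup k) //.
  by rewrite !genmxE submxMr // genmxE.
exists [ffun i => f i]; congr (\det _ != 0): detf.
by apply/row_matrixP => i; rewrite !rowK ffunE.
Qed.

(* Keeping only one rank-one term [A (f i)] per row of [H] lowers the
   determinant, by monotonicity. *)
Lemma det_kraus_ge_transversal (R : realType) (I : finType) (N : nat)
    (A : I -> 'M[R]_N) (H : 'M[R]_N) (D : 'rV[R]_N) (f : {ffun 'I_N -> I}) :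
  (forall i, 0 < D 0 i) -> \det (transversal_mx A f H) != 0 ->
  \det (transversal_mx A f H) ^+ 2 * \prod_i D 0 i
    <= \det (kraus A (H^T *m diag_mx D *m H)).
Proof.
move=> D_gt0; set M := transversal_mx A f H => detM.
have pM : posdef (M^T *m diag_mx D *m M).
  apply: posdef_congr; first exact: posdef_diag.
  have uM : M \in unitmx by rewrite unitmxE unitfE.
  by move=> u Mu0; rewrite -[u](mulKmx uM) Mu0 mulmx0.
(* With these vectors the value of the map is the sum of c^T c over all pairs (i, k), and the pairs
   with k = f i make up [M^T *m diag_mx D *m M]. *)
pose c (p : 'I_N * I) := Num.sqrt (D 0 p.1) *: (row p.1 H *m A p.2).
have cE i k : (c (i, k))^T *m c (i, k)
            = D 0 i *: ((row i H *m A k)^T *m (row i H *m A k)).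
  rewrite /c /= [(_ *: _)^T]linearZ /= -scalemxAl -scalemxAr scalerA.
  by rewrite -expr2 sqr_sqrtr // ltW.
have -> : kraus A (H^T *m diag_mx D *m H)
    = M^T *m diag_mx D *m M
      + \sum_(p <- [seq p <- index_enum _ | p.2 != f p.1]) (c p)^T *m c p.
  rewrite big_filter.
  have -> : M^T *m diag_mx D *m M = \sum_(p : 'I_N * I | p.2 == f p.1)
      (c p)^T *m c p.
    rewrite congr_diag_mxE.
    rewrite (reindex_onto (fun i => (i, f i)) fst) /=; last first.
      by case=> i k /= /eqP ->.
    apply: eq_big => [i|i _]; first by rewrite !eqxx.
    by rewrite cE rowK.
  transitivity (\sum_(p : 'I_N * I) (c p)^T *m c p); last first.
    by rewrite (bigID (fun p : 'I_N * I => p.2 == f p.1)).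
  rewrite /kraus.
  rewrite -(pair_bigA _ (fun i k => (c (i, k))^T *m c (i, k))) /= exchange_big.
  apply: eq_bigr => k _; rewrite !mulmxA -trmx_mul -mulmxA congr_diag_mxE.
  by apply: eq_bigr => i _; rewrite cE row_mul.
apply: le_trans (det_add_sum_rank1_ge _ _ pM).
by rewrite !det_mulmx det_tr det_diag [X in _ <= X]mulrAC -expr2.
Qed.

Lemma det_kraus_lower_bound (R : realType) (I : finType) (N : nat)
    (A : I -> 'M[R]_N) :
  rank_nondecreasing A ->
  exists2 c : R, 0 < c &
    forall X, posdef X -> c * \det X <= \det (kraus A X).
Proof.
move=> ndA.
have trA := fun H => @rank_nondecreasing_transversal _ _ _ A H ndA.
have [c c_gt0 cP] := transversal_det_lower_bound trA.
have [|f0 _] := trA 1%:M; first by rewrite det1 oner_eq0.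
have card_gt0 : (0 < #|{ffun 'I_N -> I}|)%N by apply/card_gt0P; exists f0.
(* The best [f] reaches at least the average of the sum bounded by [c], whence the division by the
   number of choice functions. *)
exists (c / #|{ffun 'I_N -> I}|%:R); first by rewrite divr_gt0 ?ltr0n.
move=> X /posdef_pivoted_LDL[H [D [XE Hle detH D_gt0]]].
pose F (f : {ffun 'I_N -> I}) := \det (transversal_mx A f H) ^+ 2.
pose f := [arg max_(f > f0) F f]%O.
have maxf g : F g <= F f.
  by rewrite /f; case: Order.TotalTheory.arg_maxP => // h _; apply.
have leF : c / #|{ffun 'I_N -> I}|%:R <= F f.
  rewrite ler_pdivrMr ?ltr0n //; apply: le_trans (cP H Hle detH) _.
  rewrite mulr_natr -sumr_const; apply: ler_sum => g _; exact: maxf.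
have detf : \det (transversal_mx A f H) != 0.
  rewrite -sqrf_eq0 gt_eqF // (lt_le_trans _ leF) //.
  by rewrite divr_gt0 ?ltr0n.
have detX : \det X = \prod_i D 0 i.
  by rewrite XE !det_mulmx det_tr det_diag mulrAC -expr2 detH mul1r.
rewrite detX; apply: le_trans (ler_wpM2r _ leF) _.
  by apply: prodr_ge0 => i _; exact: ltW.
by rewrite XE; exact: det_kraus_ge_transversal.
Qed.

(** Each factor of the Leibniz expansion is bounded uniformly for s in [0, 1]. This controls what is
    left of the determinant once the powers of s are extracted. *)
Lemma det_pencil_bounded (R : realType) (N : nat) (P0 P1 : 'M[R]_N) :
  exists C : R, forall s, 0 <= s <= 1 -> `|\det (P0 + s *: P1)| <= C.
Proof.
exists (\sum_(g : 'S_N) \prod_i (`|P0 i (g i)| + `|P1 i (g i)|)).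
move=> s /andP[s_ge0 s_le1]; apply: le_trans (ler_norm_sum _ _ _) _.
apply: ler_sum => g _; rewrite normrM normrX normrN1 expr1n mul1r normr_prod.
apply: ler_prod => i _; rewrite normr_ge0 !mxE /=.
apply: le_trans (ler_normD _ _) _; rewrite lerD2l normrM ger0_norm //.
by rewrite ler_piMl.
Qed.

Lemma scaled_pidE (R : comPzRingType) (N z : nat) (s : R) :
  s *: pid_mx z + copid_mx z
    = diag_mx (\row_i (if (i < z)%N then s else 1)) :> 'M[R]_N.
Proof.
apply/matrixP => i j; rewrite !mxE -val_eqE /=.
by case: (_ == _); case: (i < z)%N; rewrite /= ?mulr1n ?mulr0n; ring.
Qed.

Lemma det_scaled_pid (R : comPzRingType) (N z : nat) (s : R) : (z <= N)%N ->
  \det (s *: pid_mx z + copid_mx z : 'M[R]_N) = s ^+ z.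
Proof.
move=> zN; rewrite scaled_pidE det_diag; under eq_bigr do rewrite mxE.
rewrite -big_mkcond /= -(big_ord_widen _ (fun=> s) zN).
by rewrite prodr_const card_ord.
Qed.

Lemma posdef_scaled_pid (R : realType) (N z : nat) (s : R) : 0 < s ->
  posdef (s *: pid_mx z + copid_mx z : 'M[R]_N).
Proof.
move=> s_gt0; rewrite scaled_pidE; apply: posdef_diag => i.
by rewrite mxE; case: ifP.
Qed.

Lemma krausD (R : realType) (I : finType) (N1 N2 : nat)
    (A : I -> 'M[R]_(N1, N2)) (X Y : 'M[R]_N1) :
  kraus A (X + Y) = kraus A X + kraus A Y.
Proof.
by rewrite /kraus -big_split; apply: eq_bigr => k _; rewrite mulmxDr mulmxDl.
Qed.

Lemma krausZ (R : realType) (I : finType) (N1 N2 : nat)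
    (A : I -> 'M[R]_(N1, N2)) (s : R) (X : 'M[R]_N1) :
  kraus A (s *: X) = s *: kraus A X.
Proof.
rewrite /kraus scaler_sumr; apply: eq_bigr => k _.
by rewrite -scalemxAr -scalemxAl.
Qed.

(** Since p C kills T2, the p-part of the left side is divisible by s, and the factor s p + q splits
    off; its determinant will carry the power of s. *)
Lemma projected_pencil (R : comPzRingType) (N : nat)
    (p q C T1 T2 : 'M[R]_N) (s : R) :
  p *m p = p -> q *m q = q -> p *m q = 0 -> q *m p = 0 -> p + q = 1%:M ->
  p *m C *m T2 = 0 ->
  C *m (s *: T1 + T2)
    = (s *: p + q) *m (p *m C *m T1 + q *m C *m T2 + s *: (q *m C *m T1)).
Proof.
move=> pp qq pq0 qp0 pq1 pT2.
have CE T : C *m T = p *m C *m T + q *m C *m T.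
  by rewrite -!mulmxDl pq1 mul1mx.
rewrite CE !mulmxDr pT2 !mulmxDl -!scalemxAl -!scalemxAr !mulmxA pp qq pq0 qp0.
rewrite !mul0mx !scaler0 !addr0 !add0r.
by rewrite addrAC addrA.
Qed.

(* If [U] is mapped into a smaller space [Z], let [X] be [s] on [Z] and [1] on
   a complement: then [\det X] is of order [s ^+ \rank Z], whereas
   [\det (kraus A X)] is [O(s ^+ \rank U)]. *)
Lemma det_kraus_bound_rank_nondecreasing (R : realType) (I : finType) (N : nat)
    (A : I -> 'M[R]_N) (c : R) :
  0 < c -> (forall X, posdef X -> c * \det X <= \det (kraus A X)) ->
  rank_nondecreasing A.
Proof.
move=> c_gt0 leA U; rewrite leqNgt; apply/negP.
set Z : 'M_N := (\sum_k _)%MS => ltZU.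
set z := \rank Z in ltZU *; set u := \rank U in ltZU *.
have zN : (z <= N)%N := rank_leq_row Z; have uN : (u <= N)%N := rank_leq_row U.
pose B := row_ebase Z; pose Bi := invmx B.
have uB : B \in unitmx := row_ebase_unit Z.
pose C := row_ebase U; have uC : C \in unitmx := row_ebase_unit U.
(* In a basis adapted to [Z], the matrix [s *: X1 + X2] is diagonal with [z] entries s and the
   others 1, and [X2] vanishes on [Z]. *)
pose X1 := Bi *m pid_mx z *m Bi^T; pose X2 := Bi *m copid_mx z *m Bi^T.
have XE s : s *: X1 + X2 = Bi^T^T *m (s *: pid_mx z + copid_mx z) *m Bi^T.
  by rewrite trmxK mulmxDr mulmxDl -scalemxAr -scalemxAl.
have ZX2 : Z *m X2 = 0.
  rewrite -[Z]mulmx_ebase -/z -/B /X2 !mulmxA mulmxK //.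
  by rewrite -(mulmxA _ (pid_mx z)) mul_pid_mx_copid // mulmx0 mul0mx.
(* The first [u] rows of [C] span [U], each [A k] maps [U] into [Z], and [X2] vanishes on [Z]. *)
have CT2 : (pid_mx u : 'M_N) *m C *m kraus A X2 = 0.
  have -> : pid_mx u *m C = invmx (col_ebase U) *m U.
    rewrite -[X in _ = _ *m X]mulmx_ebase -/u -/C.
    by rewrite -[in RHS]mulmxA mulKmx ?col_ebase_unit.
  rewrite -mulmxA (_ : U *m _ = 0) ?mulmx0 // /kraus mulmx_sumr big1 // => k _.
  transitivity (U *m (A k)^T *m X2 *m A k); first by rewrite !mulmxA.
  have /submxP[W ->] : (U *m (A k)^T <= Z)%MS.
    by rewrite /Z (sumsmx_sup k) ?genmxE.
  by rewrite -(mulmxA W) ZX2 mulmx0 mul0mx.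
pose P0 := pid_mx u *m C *m kraus A X1 + copid_mx u *m C *m kraus A X2.
pose P1 := copid_mx u *m C *m kraus A X1.
have [K leK] := det_pencil_bounded P0 P1.
have factor s : C *m kraus A (s *: X1 + X2)
              = (s *: pid_mx u + copid_mx u) *m (P0 + s *: P1).
  rewrite krausD krausZ; apply: projected_pencil => //.
  - by rewrite pid_mx_id.
  - exact: copid_mx_id.
  - exact: mul_pid_mx_copid.
  - exact: mul_copid_mx_pid.
  - by rewrite addrC subrK.
(* The constants of the lower bound are gathered so that it reads s^z a <= s^u K; since z < u,
   dividing by s^z leaves a <= s K. *)
pose a := c * \det Bi ^+ 2 * `|\det C|.
have a_gt0 : 0 < a.
  have detN0 (M : 'M[R]_N) : M \in unitmx -> \det M != 0.
    by rewrite unitmxE unitfE.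
  rewrite pmulr_lgt0 ?normr_gt0 ?detN0 // pmulr_rgt0 //.
  by rewrite exprn_even_gt0 //= detN0 ?unitmx_inv.
have le_a s : 0 < s <= 1 -> a <= s * K.
  move=> /andP[s_gt0 s_le1].
  have s01 : 0 <= s <= 1 by rewrite ltW.
  have pX : posdef (s *: X1 + X2).
    rewrite XE; apply: posdef_congr; first exact: posdef_scaled_pid.
    have uBi : Bi^T \in unitmx by rewrite unitmx_tr unitmx_inv.
    by move=> v Bv0; rewrite -[v](mulKmx uBi) Bv0 mulmx0.
  have := leA _ pX; rewrite {1}XE !det_mulmx trmxK det_tr det_scaled_pid //.
  move/(ler_wpM2r (normr_ge0 (\det C))) => le1.
  have le2 : \det (kraus A (s *: X1 + X2)) * `|\det C| <= s ^+ u * K.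
    apply: le_trans (ler_norm _) _; rewrite normrM normr_id mulrC -normrM.
    rewrite -det_mulmx factor det_mulmx det_scaled_pid // normrM.
    rewrite ger0_norm ?exprn_ge0 ?(ltW s_gt0) //.
    by rewrite ler_wpM2l ?leK ?exprn_ge0 ?(ltW s_gt0).
  have K_ge0 : 0 <= K := le_trans (normr_ge0 _) (leK _ s01).
  have sz_gt0 : 0 < s ^+ z by rewrite exprn_gt0.
  have aE : s ^+ z * a = c * (\det Bi * s ^+ z * \det Bi) * `|\det C|.
    by rewrite /a; ring.
  rewrite -(ler_pM2l sz_gt0) aE; apply: le_trans (le_trans le1 le2) _.
  by rewrite mulrA -exprSr ler_wpM2r // ler_wiXn2l // ltW.
have K_gt0 : 0 < K.
  by apply: lt_le_trans a_gt0 _; rewrite -[K]mul1r le_a // ltr01 lexx.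
have aK : 0 < a + K by rewrite addr_gt0.
(* This s lies in (0, 1) but s K = a K / (a + K) < a. *)
have := le_a (a / (a + K)); rewrite divr_gt0 //= ler_pdivrMr // mul1r lerDl.
rewrite (ltW K_gt0) => /(_ isT); rewrite mulrAC ler_pdivlMr // mulrDr.
by rewrite gerDr leNgt mulr_gt0.
Qed.

Lemma pos_root (R : realType) (n : nat) (y : R) : (0 < n)%N -> 0 < y ->
  exists2 x : R, 0 < x & x ^+ n = y.
Proof.
move=> n_gt0 y_gt0.
(* The intermediate value theorem applies up to 1 + y because (1 + y)^n >= 1 + y > y. *)
have [||x /andP[x_ge0 _]] := @poly_ivt R ('X^n - y%:P) 0 (1 + y).
- by rewrite addr_ge0 ?ltW.
- rewrite !hornerE expr0n gtn_eqF //= sub0r oppr_le0 ltW //=.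
  rewrite subr_ge0; apply: le_trans (_ : 1 + y <= _); first by rewrite lerDr.
  by rewrite ler_eXnr // lerDl ltW.
rewrite /root !hornerE subr_eq0 => /eqP xy; exists x => //.
rewrite lt_neqAle x_ge0 andbT; apply: contraTneq y_gt0 => x0.
by rewrite -xy -x0 expr0n gtn_eqF // ltxx.
Qed.

Lemma posdef1 (R : realType) (N : nat) : posdef (1%:M : 'M[R]_N).
Proof.
by rewrite -diag_const_mx; apply: posdef_diag => i; rewrite mxE.
Qed.

Lemma posdef_scale (R : realType) (N : nat) (X : 'M[R]_N) (s : R) :
  0 < s -> posdef X -> posdef (s *: X).
Proof.
move=> s_gt0 [symX posX]; split=> [|u u0]; first by rewrite linearZ /= symX.
by rewrite -scalemxAr -scalemxAl mxE mulr_gt0 // posX.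
Qed.

(** Both det X and det T(X) are homogeneous of degree N, so a positive infimum over det X = 1
    amounts to a bound c det X <= det T(X) with c > 0. *)
Lemma capacity_gt0P (R : realType) (I : finType) (N1 N2 : nat)
    (A : I -> 'M[R]_(N1, N2)) : N1 = N2 ->
  0 < inf [set \det (kraus A X) | X in
             [set X : 'M[R]_N1 | posdef X /\ \det X = 1]]%classic
  <-> rank_nondecreasing A.
Proof.
move=> eN; case: N2 / eN A => A; set E := image _ _.
split=> [E_gt0|/det_kraus_lower_bound[c c_gt0 leA]]; last first.
  apply: lt_le_trans c_gt0 _; apply: lb_le_inf.
    exists (\det (kraus A 1%:M)), 1%:M => //.
    by split; [exact: posdef1 | exact: det1].
  by move=> _ [X [pX detX] <-]; rewrite -[c]mulr1 -detX leA.
(* Rescaling to determinant 1 takes an N-th root, so size 0 is treated apart. *)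
have [N0|N_gt0] := posnP N1.
  by move=> U; apply: leq_trans (rank_leq_row U) _; rewrite [X in (X <= _)%N]N0.
(* The default value of [inf] is 0, so a positive value certifies a genuine infimum, which then
   serves as the constant c. *)
have infE : has_inf E.
  by apply: contrapT => /inf_out infE; move: E_gt0; rewrite infE ltxx.
apply: (det_kraus_bound_rank_nondecreasing E_gt0) => X pX.
have detX := det_posdef_gt0 pX.
have [s s_gt0 sN] : exists2 s : R, 0 < s & s ^+ N1 = (\det X)^-1.
  by apply: pos_root; rewrite ?invr_gt0.
rewrite -ler_pdivlMr // mulrC -sN -detZ -krausZ; apply: (ge_inf infE.2).
exists (s *: X) => //; split; first exact: posdef_scale.
by rewrite detZ sN mulVf // gt_eqF.
Qed.

(** * Subspaces as row spaces and block inclusions *)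

(** The transposed basis vectors are the rows; the generated-space brackets make the matrix square
    whatever the dimension of [W]. *)
Definition vs_mx (F : fieldType) (k : nat) (W : {vspace 'cV[F]_k}) : 'M[F]_k :=
  <<\matrix_(i < \dim W) ((vbasis W)`_i)^T>>%MS.

Lemma mem_vs_mx (F : fieldType) (k : nat) (W : {vspace 'cV[F]_k}) u :
  (u^T <= vs_mx W)%MS = (u \in W).
Proof.
rewrite genmxE; apply/submxP/idP => [[c uE]|/coord_vbasis uE].
  rewrite -[u]trmxK uE mulmx_sum_row linear_sum /= memv_suml // => i _.
  rewrite linearZ /= rowK trmxK memvZ // vbasis_mem // mem_nth //.
  by rewrite size_tuple.
exists (\row_i coord (vbasis W) i u); rewrite mulmx_sum_row {1}uE linear_sum /=.
by apply: eq_bigr => i _; rewrite linearZ /= rowK mxE.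
Qed.

Lemma rank_vs_mx (F : fieldType) (k : nat) (W : {vspace 'cV[F]_k}) :
  \rank (vs_mx W) = \dim W.
Proof.
rewrite mxrank_gen; apply/eqP/inj_row_free => c; rewrite mulmx_sum_row => c0.
have /freeP/(_ (c 0)) freeW := basis_free (vbasisP W).
apply/rowP => i; rewrite mxE; apply: freeW; apply: trmx_inj.
rewrite trmx0 -[RHS]c0 linear_sum /=.
by apply: eq_bigr => j _; rewrite linearZ /= rowK.
Qed.

Definition mx_vs (F : fieldType) (k : nat) (M : 'M[F]_k) : {vspace 'cV[F]_k} :=
  limg (linfun (mulmx M^T : 'cV[F]_k -> 'cV[F]_k)).

Lemma mem_mx_vs (F : fieldType) (k : nat) (M : 'M[F]_k) (u : 'cV[F]_k) :
  (u \in mx_vs M) = (u^T <= M)%MS.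
Proof.
apply/memv_imgP/submxP => [[x _ ->]|[c uE]].
  by exists x^T; rewrite lfunE /= trmx_mul trmxK.
exists c^T; first exact: memvf.
by rewrite lfunE /= -trmx_mul -uE trmxK.
Qed.

Lemma dim_mx_vs (F : fieldType) (k : nat) (M : 'M[F]_k) :
  \dim (mx_vs M) = \rank M.
Proof.
rewrite -rank_vs_mx; apply/eqmx_rank/rV_eqP => u.
by rewrite -[u]trmxK mem_vs_mx mem_mx_vs.
Qed.

Section BlockInclusion.
Variables (F : fieldType) (n : nat) (p : 'I_n -> nat).

(** Right multiplication by this matrix embeds row vectors as the block [s]; its transpose extracts
    that block. *)
Definition block_incl (s : 'I_n) : 'M[F]_(p s, \sum_i p i) := submxcol 1%:M s.

Lemma submxrow_block_incl (s t : 'I_n) :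
  submxrow (block_incl s) t
    = if s == t then conform_mx (0 : 'M_(p s, p t)) (1%:M : 'M_(p s)) else 0.
Proof.
rewrite /block_incl -submxblockEv -(mxdiagZ 1) mxblockK.
by [].
Qed.

Lemma mul_tr_block_incl (k : nat) (U : 'M[F]_(k, \sum_i p i)) (s : 'I_n) :
  U *m (block_incl s)^T = submxrow U s.
Proof. by rewrite /block_incl tr_submxcol trmx1 mul_submxrow mulmx1. Qed.

Lemma submxcol_mxdiag (W : forall i, 'M[F]_(p i)) (s : 'I_n) :
  submxcol (\mxdiag_i W i) s = W s *m block_incl s.
Proof.
apply/mxrowP => t; rewrite -submxblockEv mxblockK -mul_submxrow.
rewrite submxrow_block_incl; case: eqP => [st|_]; last by rewrite mulmx0.
by case: t / st; rewrite !conform_mx_id mulmx1.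
Qed.

Lemma sub_mxdiag (k : nat) (W : forall i, 'M[F]_(p i))
    (U : 'M[F]_(k, \sum_i p i)) :
  (forall s, (submxrow U s <= W s)%MS) -> (U <= \mxdiag_i W i)%MS.
Proof.
move=> UW; rewrite -[U]submxrowK; apply/submxP.
exists (\mxrow_i (submxrow U i *m pinvmx (W i))).
by rewrite mul_mxrow_mxdiag; apply: eq_mxrow => i; rewrite mulmxKpV.
Qed.

Lemma mxdiag_sub (k : nat) (W : forall i, 'M[F]_(p i))
    (U : 'M[F]_(k, \sum_i p i)) :
  (forall s, (W s *m block_incl s <= U)%MS) -> (\mxdiag_i W i <= U)%MS.
Proof.
move=> WU; rewrite -[\mxdiag_i _]submxcolK eqmx_col.
by apply/sumsmx_subP => s _; rewrite genmxE submxcol_mxdiag.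
Qed.

Lemma block_incl_sub_mxdiag (k : nat) (W : forall i, 'M[F]_(p i)) (s : 'I_n)
    (M : 'M[F]_(k, p s)) :
  (M <= W s)%MS -> (M *m block_incl s <= \mxdiag_i W i)%MS.
Proof.
case/submxP=> c ->; rewrite -mulmxA -submxcol_mxdiag.
apply: submx_trans (submxMl _ _) _.
by rewrite -[X in (_ <= X)%MS]submxcolK eqmx_col (sumsmx_sup s) ?genmxE.
Qed.

Lemma submxrow_mxdiag_sub (W : forall i, 'M[F]_(p i)) (s : 'I_n) :
  (submxrow (\mxdiag_i W i) s <= W s)%MS.
Proof.
rewrite -mul_tr_block_incl; apply/submxP.
exists (block_incl s)^T; apply: trmx_inj; rewrite !trmx_mul !trmxK tr_mxdiag.
rewrite -(submxcol_mxdiag (fun i => (W i)^T)).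
by rewrite /block_incl submxcol_mul mul1mx.
Qed.

End BlockInclusion.

(** * The Brascamp-Lieb operator of a quiver representation *)

Section Quiver.
Variables (R : realType) (Q : quiver) (n m : nat).
Variables (v : 'I_n -> Q) (w : 'I_m -> Q).
Hypothesis Qbipartite : bipartition v w.
Variables (d : Q -> nat) (sigma : Q -> int) (V : rep R d).

Local Notation rowidx := 'I_(nblock_rows w sigma).
Local Notation colidx := 'I_(nblock_cols v sigma).

Definition BL_index : finType :=
  ('I_n * 'I_m * arrow Q * rowidx * colidx)%type.

Definition BL_arrow (k : BL_index) : arrow Q := k.1.1.2.
Definition BL_row (k : BL_index) : rowidx := k.1.2.
Definition BL_col (k : BL_index) : colidx := k.2.

Definition BL_admissible (k : BL_index) : bool :=
  [&& BL_arrow k \in arrows_between v w k.1.1.1.1 k.1.1.1.2,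
      BL_row k \in Iminus w sigma k.1.1.1.2
    & BL_col k \in Iplus v sigma k.1.1.1.1].

(* Inadmissible tuples contribute zero, so that the index is a plain finType. *)
Definition BL_kraus (k : BL_index) : 'M[R]_(Nrows d w sigma, Ncols d v sigma) :=
  if BL_admissible k then BL_block V (BL_arrow k) (BL_row k) (BL_col k)
  else 0.

Lemma BL_operatorE (X : 'M[R]_(Nrows d w sigma)) :
  BL_operator v V X = kraus BL_kraus X.
Proof.
rewrite /BL_operator pair_bigA /= !pair_big_dep /= big_mkcond.
apply: eq_bigr => -[[[[i j] a] q] r] _.
rewrite /BL_kraus /BL_admissible /BL_arrow /BL_row /BL_col /=.
by case: and3P => [[-> -> ->]|]; rewrite ?mulmx0 // -andbA; case: and3P.
Qed.

Lemma BL_admissibleP (k : BL_index) : BL_admissible k ->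
  qtail (BL_arrow k) = v (col_source (BL_col k)) /\
  qhead (BL_arrow k) = w (row_sink (BL_row k)).
Proof.
case/and3P; rewrite inE mem_Iminus mem_Iplus.
by move=> /andP[/eqP-> /eqP->] /eqP-> /eqP->.
Qed.

Lemma BL_index_exists (a : arrow Q) (q : rowidx) (r : colidx) :
  qtail a = v (col_source r) -> qhead a = w (row_sink q) ->
  exists k, [/\ BL_admissible k, BL_arrow k = a, BL_row k = q & BL_col k = r].
Proof.
move=> ta ha; exists (col_source r, row_sink q, a, q, r); split=> //.
rewrite /BL_admissible /BL_arrow /BL_row /BL_col /=.
by rewrite inE mem_Iminus mem_Iplus ta ha !eqxx.
Qed.

(** The endpoints are separate arguments so that [V a] can be used when they agree with those of [a]
    only propositionally; the default 0 is returned when the sizes differ. *)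
Definition rep_at (a : arrow Q) (y x : Q) : 'M[R]_(d y, d x) :=
  conform_mx (0 : 'M_(d y, d x)) (V a).

Lemma mul_tr_BL_block (k : nat) (U : 'M[R]_(k, Ncols d v sigma))
    (a : arrow Q) (q : rowidx) (r : colidx) :
  U *m (BL_block V a q r)^T
    = submxrow U r *m (rep_at a (w (row_sink q)) (v (col_source r)))^T
      *m block_incl R (@row_size Q d m w sigma) q.
Proof.
rewrite -mul_tr_block_incl -!mulmxA; congr (_ *m _); apply: trmx_inj.
rewrite !trmx_mul !trmxK /BL_block.
rewrite -[RHS]submxblockK; apply: eq_mxblock => q' r'.
rewrite submxblockEh -mul_submxrow -!submxcol_mul -tr_submxrow.
rewrite !submxrow_block_incl ![_ == q]eq_sym ![_ == r]eq_sym.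
have [<-|_] := eqVneq q q'; last by rewrite trmx0 !mul0mx.
have [<-|_] := eqVneq r r'; last by rewrite mulmx0.
by rewrite !conform_mx_id trmx1 mul1mx mulmx1.
Qed.

Lemma mul_rep_at (k : nat) (a : arrow Q) (x y : Q) (U : 'M[R]_(k, d x)) :
  qtail a = x ->
  conform_mx (0 : 'M_(k, d (qtail a))) U *m (rep_at a y (qtail a))^T
    = U *m (rep_at a y x)^T.
Proof. by move=> ta; case: x / ta U => U; rewrite conform_mx_id. Qed.

Lemma pairing_bipartite (beta : Q -> nat) :
  (forall i, 0 < sigma (v i)) -> (forall j, sigma (w j) < 0) ->
  pairing sigma beta = (\sum_i sigma_plus v sigma i * beta (v i))%N%:Z
                     - (\sum_j sigma_minus w sigma j * beta (w j))%N%:Z.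
Proof.
move=> sv sw; have [bij_vw _ _] := Qbipartite.
rewrite /pairing (reindex _ (onW_bij _ bij_vw)) /= big_sumType /=.
rewrite -!natz !natr_sum -sumrN; congr (_ + _); apply: eq_bigr => k _.
  by rewrite natrM !natz /sigma_plus gtz0_abs.
by rewrite natrM !natz /sigma_minus ltz0_abs // mulNr opprK.
Qed.

Lemma source_neq_sink (i : 'I_n) (j : 'I_m) : v i <> w j.
Proof.
have [/bij_inj inj_vw _ _] := Qbipartite.
by move=> vw; have := inj_vw (inl i) (inr j) vw.
Qed.

(** Defined at every vertex, like [snk_mx], so that the two can be added vertexwise: this one
    vanishes on sinks and the other on sources. *)
Definition src_mx (U : 'M[R]_(Ncols d v sigma)) (x : Q) : 'M[R]_(d x) :=
  (\sum_(r : colidx | v (col_source r) == x)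
     <<conform_mx (0 : 'M_(Ncols d v sigma, d x)) (submxrow U r)>>)%MS.

Definition snk_mx (U : 'M[R]_(Ncols d v sigma)) (y : Q) : 'M[R]_(d y) :=
  (\sum_(a | qhead a == y)
     <<src_mx U (qtail a) *m (rep_at a y (qtail a))^T>>)%MS.

Lemma src_mx_sink (U : 'M[R]_(Ncols d v sigma)) (j : 'I_m) :
  src_mx U (w j) = 0.
Proof. by rewrite /src_mx big1 // => r /eqP/source_neq_sink. Qed.

Lemma snk_mx_source (U : 'M[R]_(Ncols d v sigma)) (i : 'I_n) :
  snk_mx U (v i) = 0.
Proof.
have [_ _ headw] := Qbipartite.
rewrite /snk_mx big1 // => a /eqP ha; have [j haj] := headw a.
by case: (@source_neq_sink i j); rewrite -ha.
Qed.

Lemma subrep_src_snk (U : 'M[R]_(Ncols d v sigma)) :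
  subrep V (fun x => mx_vs (src_mx U x + snk_mx U x)%MS).
Proof.
move=> a u; rewrite !mem_mx_vs trmx_mul.
have [_ tailv _] := Qbipartite; have [i ta] := tailv a.
have -> : snk_mx U (qtail a) = 0 by rewrite ta snk_mx_source.
rewrite addsmx0 => uU; apply: submx_trans (addsmxSr _ _).
rewrite /snk_mx (sumsmx_sup a) // genmxE /rep_at conform_mx_id.
exact: submxMr.
Qed.

Lemma rank_src_mx (U : 'M[R]_(Ncols d v sigma)) :
  (\rank U <= \sum_i sigma_plus v sigma i * \rank (src_mx U (v i)))%N.
Proof.
rewrite -sum_blocks -(rank_mxdiag (fun r => src_mx U (v (tagnat.sig1 r)))).
apply/mxrankS/sub_mxdiag => r.
by rewrite /src_mx (sumsmx_sup r) // genmxE conform_mx_id.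
Qed.

(** Each arrow has its own Kraus operator for every compatible pair (q, r). Hence the image of any
    single block of [U] under [V a], placed at any position q of the head, already lies in the image
    of [U]. *)
Lemma rank_snk_mx (U : 'M[R]_(Ncols d v sigma)) :
  (\sum_j sigma_minus w sigma j * \rank (snk_mx U (w j))
     <= \rank (\sum_k <<U *m (BL_kraus k)^T>>)%MS)%N.
Proof.
rewrite -sum_blocks -(rank_mxdiag (fun q => snk_mx U (w (tagnat.sig1 q)))).
apply/mxrankS/mxdiag_sub => q; rewrite /snk_mx sumsmxMr_gen.
apply/sumsmx_subP => a /eqP ha; rewrite genmxE (eqmxMr _ (genmxE _)).
rewrite -mulmxA /src_mx sumsmxMr_gen; apply/sumsmx_subP => r /eqP ta.
rewrite genmxE (eqmxMr _ (genmxE _)).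
have [k [adm ka kq kr]] := BL_index_exists (esym ta) ha.
rewrite (sumsmx_sup k) // genmxE /BL_kraus adm ka kq kr mul_tr_BL_block.
by rewrite mulmxA (mul_rep_at _ _ (esym ta)).
Qed.

Hypothesis sigma_pos : forall i, 0 < sigma (v i).
Hypothesis sigma_neg : forall j, sigma (w j) < 0.

Lemma pairing_le0 (beta : Q -> nat) :
  (pairing sigma beta <= 0) =
  (\sum_i sigma_plus v sigma i * beta (v i)
     <= \sum_j sigma_minus w sigma j * beta (w j))%N.
Proof. by rewrite pairing_bipartite // subr_le0 lez_nat. Qed.

Lemma semistable_rank_nondecreasing :
  semistable sigma V -> rank_nondecreasing BL_kraus.
Proof.
move=> [_ ssV] U.
have := ssV _ (@subrep_src_snk U); rewrite pairing_le0 => le_dim.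
apply: leq_trans (rank_src_mx U) _; apply: leq_trans (rank_snk_mx U).
have -> : (\sum_j sigma_minus w sigma j * \rank (snk_mx U (w j)) =
    \sum_j sigma_minus w sigma j *
      \dim (mx_vs (src_mx U (w j) + snk_mx U (w j))%MS))%N.
  apply: eq_bigr => j _; rewrite dim_mx_vs src_mx_sink.
  by rewrite (eqmx_rank (introT eqmxP (adds0mx _ _))).
apply: leq_trans le_dim; apply: leq_sum => i _; rewrite leq_mul2l dim_mx_vs.
by rewrite mxrankS ?addsmxSl ?orbT.
Qed.

Lemma subrep_vs_mx (W : forall x : Q, {vspace 'cV[R]_(d x)}) a x y :
  subrep V W -> qtail a = x -> qhead a = y ->
  (vs_mx (W x) *m (rep_at a y x)^T <= vs_mx (W y))%MS.
Proof.
move=> subW; case: x /; case: y /; rewrite /rep_at conform_mx_id.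
apply/row_subP => i; rewrite row_mul -[row i _]trmxK -trmx_mul mem_vs_mx.
by apply: subW; rewrite -mem_vs_mx trmxK row_sub.
Qed.

(** The test space is the direct sum of one copy of W(v_i) per block position; as [W] is a
    subrepresentation, its image lies in the corresponding sum of copies of the W(w_j). *)
Lemma rank_nondecreasing_semistable :
  pairing sigma d = 0 -> rank_nondecreasing BL_kraus -> semistable sigma V.
Proof.
move=> sigma_d ndV; split=> // W subW; rewrite pairing_le0.
pose B (r : colidx) := vs_mx (W (v (tagnat.sig1 r))).
pose C (q : rowidx) := vs_mx (W (w (tagnat.sig1 q))).
have := ndV (\mxdiag_r B r); rewrite rank_mxdiag.
under eq_bigr do rewrite rank_vs_mx.
rewrite (sum_blocks _ (fun i => \dim (W (v i)))) => /leq_trans; apply.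
apply: (@leq_trans (\rank (\mxdiag_q C q))); last first.
  rewrite rank_mxdiag; under eq_bigr do rewrite rank_vs_mx.
  by rewrite (sum_blocks _ (fun j => \dim (W (w j)))).
apply/mxrankS/sumsmx_subP => k _; rewrite genmxE /BL_kraus.
case: ifP => [/BL_admissibleP[ta ha]|_]; last by rewrite trmx0 mulmx0 sub0mx.
rewrite mul_tr_BL_block; apply: block_incl_sub_mxdiag.
apply: submx_trans (submxMr _ (submxrow_mxdiag_sub _ _)) _.
exact: subrep_vs_mx.
Qed.

End Quiver.

Theorem theorem1 (R : realType) (Q : quiver) (n m : nat)
    (v : 'I_n -> Q) (w : 'I_m -> Q)
    (Qconnected : quiver_connected Q)
    (Qbipartite : bipartition v w)
    (d : Q -> nat) (sigma : Q -> int)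
    (sigma_d : pairing sigma d = 0)
    (sigma_pos : forall i : 'I_n, 0 < sigma (v i))
    (sigma_neg : forall j : 'I_m, sigma (w j) < 0)
    (V : rep R d) :
  0 < BL_capacity v w sigma V <-> semistable sigma V.
Proof.
have eN := sizeE Qbipartite sigma_pos sigma_neg sigma_d.
have -> : BL_capacity v w sigma V = inf
    [set \det (kraus (@BL_kraus _ _ _ _ v w _ sigma V) X) | X in
      [set X : 'M[R]_(Nrows d w sigma) | posdef X /\ \det X = 1]]%classic.
  by congr (inf _); apply: eq_imagel => X _; rewrite BL_operatorE.
rewrite capacity_gt0P //; split.
  exact: rank_nondecreasing_semistable.
exact: semistable_rank_nondecreasing.
Qed.
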